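(* Let $\mathbb{A}$ be any set of allowable test processes. For all $\omega\in\Omega$ and any $I,J\in\mathcal{I}$: (i) if $I\in\mathcal{I}_{\mathbb{A}}(\omega)$ and $I\subseteq J$, then $J\in\mathcal{I}_{\mathbb{A}}(\omega)$; (ii) if $I\in\mathcal{I}_{\mathrm{S}}(\omega)$ and $I\subseteq J$, then $J\in\mathcal{I}_{\mathrm{S}}(\omega)$.
   Context: Notation: $\mathbb{N}=\{1,2,\dots\}$, $\mathbb{N}_0=\mathbb{N}\cup\{0\}$. Situations are the finite binary sequences $\mathbb{S}=\bigcup_{n\in\mathbb{N}_0}\{0,1\}^n$, with $\square$ the empty sequence; $sx$ is $s$ with $x\in\{0,1\}$ appended. Paths are elements $\omega$ of $\Omega=\{0,1\}^{\mathbb{N}}$; $\omega_{1:n}\in\mathbb{S}$ consists of the first $n$ entries. $\mathcal{I}$ is the set of non-empty closed subintervals of $[0,1]$. For $f\colon\{0,1\}\to\mathbb{R}$ and $I\in\mathcal{I}$, $\overline{E}_I(f)=\max_{p\in I}[pf(1)+(1-p)f(0)]$. A forecasting system is a map $\varphi\colon\mathbb{S}\to\mathcal{I}$. For $I\in\mathcal{I}$, the stationary forecasting system $\gamma_I$ is given by $\gamma_I(s)=I$ for all $s\in\mathbb{S}$. A real process is a map $F\colon\mathbb{S}\to\mathbb{R}$, with $\Delta F(s)(x)=F(sx)-F(s)$. A test process is a non-negative real process with $F(\square)=1$. A supermartingale for $\varphi$ is a real process $M$ with $\overline{E}_{\varphi(s)}(\Delta M(s))\le 0$ for all $s\in\mathbb{S}$;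 a test supermartingale for $\varphi$ is a test process that is a supermartingale for $\varphi$. Computability: ''recursive'' means computable by a Turing machine (countable sets such as $\mathbb{S}$ and $\mathbb{S}\times\mathbb{N}_0$ are identified with $\mathbb{N}_0$ by recursive bijections with recursive inverse). A real process $F$ is computable if there are a recursive family of rationals $r_{s,n}$ and a recursive map $e\colon\mathbb{S}\times\mathbb{N}_0\to\mathbb{N}_0$ such that $n\ge e(s,N)$ implies $|r_{s,n}-F(s)|\le 2^{-N}$. A set of allowable test processes is any countable set $\mathbb{A}$ of test processes that contains all computable (strictly) positive test processes. A path $\omega$ is $\mathbb{A}$-random for $\varphi$ if $\sup_{n\in\mathbb{N}}T(\omega_{1:n})<\infty$ for every $T\in\mathbb{A}$ that is a test supermartingale for $\varphi$. A growth function is a recursive, non-decreasing, unbounded map $\rho\colon\mathbb{N}_0\to\mathbb{N}_0$. A path $\omega$ is Schnorr random for $\varphi$ if $\limsup_{n\to\infty}[T(\omega_{1:n})-\rho(n)]\le 0$ for all computable test supermartingales $T$ for $\varphi$ and all growth functions $\rho$. $\mathcal{I}_{\mathbb{A}}(\omega)=\{I\in\mathcal{I}:\omega\text{ is }\mathbb{A}\text{-random for }\gamma_I\}$ and $\mathcal{I}_{\mathrm{S}}(\omega)=\{I\in\mathcal{I}:\omega\text{ is Schnorr random for }\gamma_I\}$. *)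

(* Defs.v *)
From HB Require Import structures.
From mathcomp Require Import all_boot all_order all_algebra.
From mathcomp Require Import all_classical all_reals all_analysis.
From mathcomp Require Import zify lra.

Set Implicit Arguments.
Unset Strict Implicit.
Unset Printing Implicit Defensive.

Import Order.TTheory GRing.Theory Num.Theory.

Local Open Scope classical_set_scope.
Local Open Scope ring_scope.

(* Deterministic machines with a single two-way infinite tape over an arbitrary
   finite alphabet. [tm_trans q a = Some (q', a', d)] writes [a'], moves right
   if [d] and left otherwise, and enters state [q']; [None] means halting. *)
Record turing_machine := TuringMachine {
  tm_state : finType;
  tm_symbol : finType;
  tm_start : tm_state;
  tm_blank : tm_symbol;
  tm_mark : tm_symbol;
  tm_blank_neq_mark : tm_blank != tm_mark;
  tm_trans : tm_state -> tm_symbol -> option (tm_state * tm_symbol * bool)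
}.

(* Cells are numbered relative to the head, which therefore always scans
   cell 0; moving the head renumbers the cells. *)
Definition tape (M : turing_machine) : Type := int -> tm_symbol M.

Definition tm_config (M : turing_machine) : Type := (tm_state M * tape M)%type.

Definition tm_step (M : turing_machine) (c : tm_config M) :
    option (tm_config M) :=
  if tm_trans c.1 (c.2 0) is Some (q, a, d)
  then Some (q, fun z : int =>
                  let y := if d then z + 1 else z - 1 in
                  if y == 0 then a else c.2 y)
  else None.

Definition tm_run (M : turing_machine) (k : nat) (c : tm_config M) :
    option (tm_config M) :=
  iter k (obind (@tm_step M)) (Some c).

(* [n] in unary: [n] marks, the head on the leftmost one. *)
Definition unary_tape (M : turing_machine) (n : nat) : tape M :=
  fun z => if (0 <= z) && (z < n%:Z) then tm_mark M else tm_blank M.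

Definition tm_computes (M : turing_machine) (f : nat -> nat) : Prop :=
  forall n : nat, exists k (q : tm_state M) (t : tape M),
    [/\ tm_run k (tm_start M, unary_tape M n) = Some (q, t),
        tm_trans q (t 0) = None
      & t =1 unary_tape M (f n)].

Definition recursive (f : nat -> nat) : Prop :=
  exists M : turing_machine, tm_computes M f.

(* Recursiveness on a countable set [D] identified with the natural numbers by
   a bijection [code]. *)
Definition recursive_via (D : Type) (code : D -> nat) (f : D -> nat) : Prop :=
  exists2 g : nat -> nat, recursive g & forall d : D, f d = g (code d).

(* [true] stands for 1 and [false] for 0; [sx] is [rcons s x]. *)
Definition situation : Type := seq bool.

(* The entries of a path are numbered from 0 here: the n-th entry is
   [omega n.-1]. *)
Definition outcome_path : Type := nat -> bool.

Definition initial_segment (omega : outcome_path) (n : nat) : situation :=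
  mkseq omega n.

(* Bijective base 2, with digits 1 and 2 standing for the outcomes 0 and 1. *)
Definition code_situation (s : situation) : nat :=
  foldl (fun (m : nat) (x : bool) => (m.*2 + x.+1)%N) 0%N s.

(* Cantor's pairing function. *)
Definition code_pair (d : nat * nat) : nat := ('C((d.1 + d.2).+1, 2) + d.2)%N.

Definition code_situation_nat (d : situation * nat) : nat :=
  code_pair (code_situation d.1, d.2).

Lemma code_situation_rcons (s : situation) (x : bool) :
  code_situation (rcons s x) = ((code_situation s).*2 + x.+1)%N.
Proof. by rewrite /code_situation foldl_rcons. Qed.

Lemma code_situation_inj : injective code_situation.
Proof.
elim/last_ind => [|s x IHs] t; case/lastP: t => [|t y] //;
  rewrite ?code_situation_rcons.
- by rewrite /code_situation /=; lia.
- by rewrite /code_situation /=; lia.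
move=> e; have [e1 e2] : code_situation s = code_situation t /\ x = y.
  by move: e; case: x; case: y => /= e; split => //; lia.
by rewrite (IHs _ e1) e2.
Qed.

Lemma code_situation_surj (n : nat) : exists s, code_situation s = n.
Proof.
elim/ltn_ind: n => -[|n] IHn; first by exists [::].
have [|s Hs] := IHn n./2; first by lia.
by exists (rcons s (odd n)); rewrite code_situation_rcons Hs; lia.
Qed.

Lemma code_pair_inj : injective code_pair.
Proof.
have lt_code a b c d : (a + b < c + d)%N -> (code_pair (a, b) < code_pair (c, d))%N.
  move=> h; rewrite /code_pair /=.
  have h1 : ('C((a + b).+2, 2) <= 'C((c + d).+1, 2))%N.
    exact: (@leq_bin2l (a + b).+2 (c + d).+1 2).
  by move: h1; rewrite binS bin1; lia.
move=> [a b] [c d] e.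
have [h|h|h] := ltngtP (a + b)%N (c + d)%N.
- by have := lt_code _ _ _ _ h; rewrite e ltnn.
- by have := lt_code _ _ _ _ h; rewrite e ltnn.
move: e; rewrite /code_pair /= h => /addnI e; subst d.
by move: h => /addIn ->.
Qed.

Lemma code_pair_surj (n : nat) : exists d, code_pair d = n.
Proof.
elim: n => [|n [[[|a] b] <-]]; first by exists (0%N, 0%N).
- exists (b.+1, 0%N); have := binS b.+1 1; rewrite bin1 /code_pair /= !addn0 add0n; lia.
- by exists (a, b.+1); rewrite /code_pair /= addnS addSn addnS.
Qed.

Lemma code_situation_nat_inj : injective code_situation_nat.
Proof.
by move=> [s m] [t n] /code_pair_inj [/code_situation_inj-> ->].
Qed.

Lemma code_situation_nat_surj (n : nat) : exists d, code_situation_nat d = n.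
Proof.
have [[m k] <-] := code_pair_surj n; have [s Hs] := code_situation_surj m.
by exists (s, k); rewrite /code_situation_nat /= Hs.
Qed.

(* A non-empty closed subinterval of [0,1], through its end points. *)
Record cinterval (R : realType) := CInterval {
  lower : R;
  upper : R;
  cintervalP : 0 <= lower /\ lower <= upper /\ upper <= 1
}.

Definition points (R : realType) (I : cinterval R) : set R :=
  [set p | lower I <= p <= upper I].

Definition upper_expectation (R : realType) (I : cinterval R)
    (f : bool -> R) : R :=
  sup [set p * f true + (1 - p) * f false | p in points I].

(* The supremum in [upper_expectation] is a maximum. *)
Lemma upper_expectation_max (R : realType) (I : cinterval R) (f : bool -> R) :
  (exists2 p, points I p &
     upper_expectation I f = p * f true + (1 - p) * f false) /\
  (forall p, points I p ->
     p * f true + (1 - p) * f false <= upper_expectation I f).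
Proof.
have [l0 [lu u1]] := cintervalP I.
set g := fun p => p * f true + (1 - p) * f false.
have [q Iq qmax] : exists2 q, points I q & forall p, points I p -> g p <= g q.
  have [h|h] := leP (f false) (f true).
    exists (upper I); first by rewrite /points /= lu lexx.
    by move=> p /andP[_ ?]; rewrite /g; nra.
  exists (lower I); first by rewrite /points /= lu lexx.
  by move=> p /andP[? _]; rewrite /g; nra.
have ub : ubound [set g p | p in points I] (g q) by move=> _ [p Ip <-]; exact: qmax.
have -> : upper_expectation I f = g q.
  apply/eqP; rewrite eq_le; apply/andP; split.
    by apply: ge_sup => //; exists (g q), q.
  by apply: ub_le_sup; [exists (g q)|exists q].
by split => //; exists q.
Qed.

Definition forecasting_system (R : realType) : Type := situation -> cinterval R.

Definition stationary (R : realType) (I : cinterval R) : forecasting_system R :=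
  fun _ => I.

Definition real_process (R : realType) : Type := situation -> R.

Definition increment (R : realType) (F : real_process R) (s : situation)
    (x : bool) : R :=
  F (rcons s x) - F s.

Definition test_process (R : realType) (F : real_process R) : Prop :=
  (forall s, 0 <= F s) /\ F [::] = 1.

Definition positive_process (R : realType) (F : real_process R) : Prop :=
  forall s, 0 < F s.

Definition supermartingale (R : realType) (phi : forecasting_system R)
    (M : real_process R) : Prop :=
  forall s, upper_expectation (phi s) (increment M s) <= 0.

Definition test_supermartingale (R : realType) (phi : forecasting_system R)
    (T : real_process R) : Prop :=
  test_process T /\ supermartingale phi T.

(* Signs, numerators and denominators are given by recursive maps. *)
Definition recursive_rationals (r : situation * nat -> rat) : Prop :=
  exists sg a b : situation * nat -> nat,
    [/\ recursive_via code_situation_nat sg,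
        recursive_via code_situation_nat a,
        recursive_via code_situation_nat b
      & forall d, (0 < b d)%N /\ r d = (-1) ^+ sg d * (a d)%:R / (b d)%:R].

Definition computable_process (R : realType) (F : real_process R) : Prop :=
  exists (r : situation * nat -> rat) (e : situation * nat -> nat),
    [/\ recursive_rationals r,
        recursive_via code_situation_nat e
      & forall (s : situation) (n N : nat), (e (s, N) <= n)%N ->
          `|ratr (r (s, n)) - F s| <= 2 ^- N].

Definition allowable (R : realType) (A : set (real_process R)) : Prop :=
  [/\ countable A,
      forall F, A F -> test_process F
    & forall F, computable_process F -> positive_process F ->
        test_process F -> A F].

Definition random (R : realType) (A : set (real_process R))
    (phi : forecasting_system R) (omega : outcome_path) : Prop :=
  forall T, A T -> test_supermartingale phi T ->
    (ereal_sup [set (T (initial_segment omega n))%:E | n in [set n | (0 < n)%N]]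
     < +oo)%E.

Definition growth_function (rho : nat -> nat) : Prop :=
  [/\ recursive rho,
      {homo rho : m n / (m <= n)%N}
    & forall B : nat, exists n, (B < rho n)%N].

Definition schnorr_random (R : realType) (phi : forecasting_system R)
    (omega : outcome_path) : Prop :=
  forall (T : real_process R) (rho : nat -> nat),
    computable_process T -> test_supermartingale phi T -> growth_function rho ->
    (limn_esup (fun n : nat => (T (initial_segment omega n) - (rho n)%:R)%:E)
     <= 0)%E.

Definition random_intervals (R : realType) (A : set (real_process R))
    (omega : outcome_path) : set (cinterval R) :=
  [set I | random A (stationary I) omega].

Definition schnorr_intervals (R : realType) (omega : outcome_path) :
    set (cinterval R) :=
  [set I | schnorr_random (stationary I) omega].

(* Main.v *)
Require Import Defs.
From mathcomp Require Import all_boot all_order all_algebra.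
From mathcomp Require Import all_classical all_reals all_analysis.

Local Open Scope classical_set_scope.

(** Upper expectation is a maximum over the interval, so it grows with the interval. The
    supermartingale inequality is thus harder to satisfy for [J] than for [I], and there are fewer
    test supermartingales for [J]. Both randomness notions quantify universally over these, so
    randomness passes from [I] to [J]. *)

Lemma le_upper_expectation (R : realType) (I J : cinterval R)
    (f : bool -> R) :
  points I `<=` points J ->
  (upper_expectation I f <= upper_expectation J f)%R.
Proof.
(* The maximiser [p] over [I] also competes in the maximum over [J]. *)
move=> IJ; have [[p Ip ->] _] := upper_expectation_max I f.
by have [_] := upper_expectation_max J f; apply; exact: IJ.
Qed.

Lemma test_supermartingale_stationary_sub (R : realType) (I J : cinterval R)
    (T : real_process R) :
  points I `<=` points J ->
  test_supermartingale (stationary J) T ->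
  test_supermartingale (stationary I) T.
Proof.
move=> IJ [Ttest TJ]; split=> // s.
by apply: Order.POrderTheory.le_trans (TJ s); exact: le_upper_expectation.
Qed.

Theorem proposition26 (R : realType) (A : set (real_process R))
    (hA : allowable A) (omega : outcome_path) (I J : cinterval R) :
  (random_intervals A omega I -> points I `<=` points J ->
   random_intervals A omega J) /\
  (schnorr_intervals omega I -> points I `<=` points J ->
   schnorr_intervals omega J).
Proof.
(* Membership in [A], computability and growth do not involve the interval; only the supermartingale
   condition must be transferred. *)
split=> [rI IJ T AT TJ | rI IJ T rho cT TJ grho].
  by apply: rI => //; exact: (test_supermartingale_stationary_sub _ _ _ _ IJ TJ).
by apply: rI => //; exact: (test_supermartingale_stationary_sub _ _ _ _ IJ TJ).
Qed.
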